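(* The length of the search trajectory of the Shaded-Contour-Exploration algorithm (defined in the context) is upper bounded by $(2.4K-1.4)L$, where $L=\|\mathbf x_{\rm b}-\mathbf x_{\rm u}\|$ is the horizontal distance from the base station to the user and $K$ is the number of propagation segments.
   Context: Setting. Fix $K\ge 1$, distinct points $\mathbf x_{\rm b},\mathbf x_{\rm u}\in\mathbb R^2$ (horizontal positions of base station and user), $L=\|\mathbf x_{\rm b}-\mathbf x_{\rm u}\|$, heights $H_{\rm d}>H_{\rm b}$, $H_{\rm d}>H_{\rm u}\ge 0$, and constants $\alpha_0,\dots,\alpha_K>1$, $\beta_0,\dots,\beta_K>0$. Let $d_{\rm b}(\mathbf x)=\sqrt{\|\mathbf x-\mathbf x_{\rm b}\|^2+(H_{\rm d}-H_{\rm b})^2}$, $d_{\rm u}(\mathbf x)=\sqrt{\|\mathbf x-\mathbf x_{\rm u}\|^2+(H_{\rm d}-H_{\rm u})^2}$. Let $\mathbb R^2=\mathcal D_1\cup\dots\cup\mathcal D_K$ be a partition into disjoint segments with $\mathbf x_{\rm u}\in\mathcal D_1$. Set $g_{\rm b}(\mathbf x)=\beta_0 d_{\rm b}(\mathbf x)^{-\alpha_0}$, $g_{\rm u}^{(k)}(\mathbf x)=\beta_k d_{\rm u}(\mathbf x)^{-\alpha_k}$ and $g_{\rm u}(\mathbf x)=g_{\rm u}^{(k)}(\mathbf x)$ for $\mathbf x\in\mathcal D_k$. Assume (order) $g_{\rm u}^{(k)}(\mathbf x)<g_{\rm u}^{(k-1)}(\mathbf x)$ for all $\mathbf x$ and $k=2,\dots,K$;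 (nestedness) if $\mathbf x\in\mathcal D_k$ and $0\le\rho\le1$ then $\mathbf x_{\rm u}+\rho(\mathbf x-\mathbf x_{\rm u})\in\mathcal D_j$ for some $j\le k$. The cost $f:(0,\infty)^2\to\mathbb R$ is continuous and decreasing in each of its two arguments (and regular enough for the algorithm below to be defined). Polar representation. $\mathbf u=(\mathbf x_{\rm b}-\mathbf x_{\rm u})/L$, $\mathbf M(\theta)$ is the rotation matrix by angle $\theta$, $\mathbf x(\rho,\theta)=\mathbf x_{\rm u}+\rho\,\mathbf M(\theta)\mathbf u$, $F_k(\rho,\theta)=f\big(g_{\rm u}^{(k)}(\mathbf x(\rho,\theta)),g_{\rm b}(\mathbf x(\rho,\theta))\big)$. Partial derivatives are one-sided: $\frac{\partial h(x_0,y_0)}{\partial x}=\lim_{t\uparrow0}\frac1t[h(x_0+t,y_0)-h(x_0,y_0)]$. Algorithm (Shaded-Contour-Exploration, continuous time, i.e. infinitesimal step size $\delta=\kappa\,dt$, with speed $\kappa>0$). For $k\le K-1$ let $\rho_k^0$ minimize $F_k(\rho,0)$ over $\rho\ge0$ with $\mathbf x(\rho,0)\in\bigcup_{j\le k}\mathcal D_j$ (presupposed to exist). Step 1: the UAV moves from the base station towards the user along the base station–user axis (a segment of length $L$) to find the critical points $\mathbf x(\rho_k^0,0)$; set $k=1$. Step 2 (right branch): start at $\mathbf x(\rho_k^0,\delta/\rho_k^0)$ with $\delta\to0$, i.e. at $\mathbf x(\rho_k^0,0)$ on the side $\theta>0$. Step 3: with $\mathbf x=\mathbf x(\rho,\theta)$,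 (a) if $\mathbf x\in\bigcup_{j\le k}\mathcal D_j$, move radially away from the user: $\dot\rho=\kappa$, $\dot\theta=0$; (b) otherwise move with speed $\kappa$ along the contour $F_k=\text{const}$, away from the user: $\dot{\mathbf x}=\kappa\bar\gamma\big[\mathbf M(\theta)\mathbf u+\rho\,\mathbf M'(\theta)\mathbf u\,(-\tfrac{\partial F_k}{\partial\theta})^{-1}\tfrac{\partial F_k}{\partial\rho}\big]$, $\bar\gamma>0$ normalizing the speed; stop as soon as $\rho\ge L\cos\theta$ or $\partial F_k(\rho,\theta)/\partial\rho\ge0$. Step 4 (left branch): start at $\mathbf x(\rho_k^0,-\delta/\rho_k^0)$, $\delta\to0$, and repeat Step 3 on the side $\theta<0$. Step 5: replace $k$ by $k+1$ and repeat from Step 2 until $k>K-1$. The length of the search trajectory is the length of the axis search of Step 1 plus the sum of the lengths of the $2(K-1)$ branches (right and left for each $k=1,\dots,K-1$); repositioning between branches is not counted. *)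

(* Defs.v *)
(* MathComp-Analysis, over an abstract [R : realType]. *)
From HB Require Import structures.
From mathcomp Require Import all_boot all_order all_algebra.
From mathcomp Require Import all_classical all_reals all_analysis.

Set Implicit Arguments.
Unset Strict Implicit.
Unset Printing Implicit Defensive.

Import Order.TTheory GRing.Theory Num.Theory.
Import numFieldNormedType.Exports.
Local Open Scope classical_set_scope.
Local Open Scope ring_scope.

(* The library norm on ['cV[R]_2] is the max norm, hence this one. *)
Definition enorm (R : realType) (x : 'cV[R]_2) : R :=
  Num.sqrt (\sum_i x i 0 ^+ 2).

Definition rotmx (R : realType) (t : R) : 'M[R]_2 :=
  \matrix_(i, j) if i == j then cos t
                 else if (i < j)%N then - sin t else sin t.

(* entrywise derivative of [rotmx] *)
Definition drotmx (R : realType) (t : R) : 'M[R]_2 :=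
  \matrix_(i, j) if i == j then - sin t
                 else if (i < j)%N then - cos t else cos t.

(* One-sided derivative, with increments t tending to 0 from below. *)
Definition is_lderive (R : realType) (h : R -> R) (x d : R) : Prop :=
  t^-1 * (h (x + t) - h x) @[t --> 0^'-] --> d.

(* Euclidean arc length of [x] over [a, b]: supremum of the lengths of the
   inscribed polygonal lines.  The real-valued [sup] is meaningful because it
   is only applied to curves that are Lipschitz on [a, b]. *)
Definition polygon_length (R : realType) (a b : R) (x : R -> 'cV[R]_2)
    (s : seq R) : R :=
  let p := x \o nth b (a :: s) in
  \sum_(0 <= i < size s) enorm (p i.+1 - p i).

Definition arc_length (R : realType) (a b : R) (x : R -> 'cV[R]_2) : R :=
  sup [set polygon_length a b x s | s in itv_partition a b].

Record scenario (R : realType) := Scenario {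
  xb : 'cV[R]_2;
  xu : 'cV[R]_2;
  Hd : R;
  Hb : R;
  Hu : R;
  alpha : nat -> R;
  beta : nat -> R;
  seg : nat -> set 'cV[R]_2;  (* the segments D_k, 1 <= k <= K *)
  cost : R * R -> R           (* f, only meaningful on (0, oo)^2 *)
}.

Section Geometry.
Variables (R : realType) (S : scenario R).

Definition L : R := enorm (xb S - xu S).

Definition db (x : 'cV[R]_2) : R :=
  Num.sqrt (enorm (x - xb S) ^+ 2 + (Hd S - Hb S) ^+ 2).
Definition du (x : 'cV[R]_2) : R :=
  Num.sqrt (enorm (x - xu S) ^+ 2 + (Hd S - Hu S) ^+ 2).

Definition gb (x : 'cV[R]_2) : R := beta S 0%N * db x `^ (- alpha S 0%N).
Definition gu (k : nat) (x : 'cV[R]_2) : R := beta S k * du x `^ (- alpha S k).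

Record standing_assumptions (K : nat) : Prop := StandingAssumptions {
  K_ge1 : (1 <= K)%N;
  xb_neq_xu : xb S != xu S;
  Hb_lt_Hd : Hb S < Hd S;
  Hu_lt_Hd : Hu S < Hd S;
  Hu_ge0 : 0 <= Hu S;
  alpha_gt1 : forall k, (k <= K)%N -> 1 < alpha S k;
  beta_gt0 : forall k, (k <= K)%N -> 0 < beta S k;
  seg_cover : cover [set k | (1 <= k <= K)%N] (seg S) = setT;
  seg_disjoint : trivIset [set k | (1 <= k <= K)%N] (seg S);
  xu_seg1 : seg S 1%N (xu S);
  gu_order : forall k x, (2 <= k <= K)%N -> gu k x < gu k.-1 x;
  seg_nested : forall k x (r : R), (1 <= k <= K)%N -> seg S k x ->
    0 <= r <= 1 ->
    exists2 j, (1 <= j <= k)%N & seg S j (xu S + r *: (x - xu S));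
  cost_continuous :
    {within [set p | 0 < p.1 /\ 0 < p.2], continuous (cost S)};
  (* Monotonicity is not required to be strict, so that costs such as
     max (- a, - b) are allowed. *)
  cost_decr1 : forall a a' b, 0 < a -> a <= a' -> 0 < b ->
    cost S (a', b) <= cost S (a, b);
  cost_decr2 : forall a b b', 0 < a -> 0 < b -> b <= b' ->
    cost S (a, b') <= cost S (a, b)
}.

Definition axis : 'cV[R]_2 := L^-1 *: (xb S - xu S).

Definition polar (rho theta : R) : 'cV[R]_2 :=
  xu S + rho *: (rotmx theta *m axis).

Definition costk (k : nat) (x : 'cV[R]_2) : R := cost S (gu k x, gb x).
Definition F (k : nat) (rho theta : R) : R := costk k (polar rho theta).

Definition upto (k : nat) : set 'cV[R]_2 :=
  \bigcup_(j in [set j | (1 <= j <= k)%N]) seg S j.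

Definition is_critical (k : nat) (r : R) : Prop :=
  [/\ 0 <= r, upto k (polar r 0) &
      forall r', 0 <= r' -> upto k (polar r' 0) -> F k r 0 <= F k r' 0].

Definition stopped (k : nat) (rho theta : R) : Prop :=
  L * cos theta <= rho \/
  exists2 d, is_lderive (fun r => F k r theta) rho d & 0 <= d.

(* Velocities prescribed by the contour rule at [polar rho theta].
   Differentiable costs are not assumed, so besides being given by the formula, [v] is required
   to be the direction of an arc of the level set {F_k = const}: at a kink of
   the cost the one-sided derivatives alone may yield a transversal direction.
   For a C^1 cost this clause follows from the formula. *)
Definition contour_velocity (kappa : R) (k : nat) (rho theta : R)
    (v : 'cV[R]_2) : Prop :=
  (exists drho dtheta gamma : R,
    [/\ is_lderive (fun r => F k r theta) rho drho,
        is_lderive (fun t => F k rho t) theta dtheta /\ dtheta != 0,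
        0 < gamma,
        enorm v = kappa &
        v = (kappa * gamma) *:
            (rotmx theta *m axis
             + (rho * ((- dtheta)^-1 * drho)) *: (drotmx theta *m axis))]) /\
  exists c : R -> 'cV[R]_2,
    [/\ c 0 = polar rho theta,
        s^-1 *: (c s - c 0) @[s --> 0^'+] --> v &
        \forall s \near 0^'+, costk k (c s) = costk k (c 0)].

(* For [r0 = 0], where delta / r0 is meaningless, any small angle will do. *)
Definition start_angle (delta r0 : R) : R :=
  if r0 == 0 then delta else delta / r0.

(* A run of duration [T] of the branch number [k], on the side theta > 0 for
   [sigma = 1] and theta < 0 for [sigma = -1], with step size [delta].  The
   velocity at time t is chosen by locating the position at some time s of the
   last step, i.e. within a flown distance [delta] before t.  This covers both
   the equations of motion taken literally (s = t) and the algorithm that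
   decides once per step of length [delta]; the latter is needed in the limit
   delta -> 0 because along a boundary of the segments that both rules push
   towards, the literal equations have no solution.
   The run may be cut before the stopping criterion is first met. *)
Definition branch_run (kappa : R) (k : nat) (sigma r0 delta T : R)
    (rho theta : R -> R) : Prop :=
  let x := fun t => polar (rho t) (theta t) in
  [/\ rho 0 = r0 /\ theta 0 = sigma * start_angle delta r0,
      {within `[0, T], continuous rho} /\ {within `[0, T], continuous theta},
      (forall s t, 0 <= s -> s <= t -> t <= T ->
         0 <= rho t /\ enorm (x t - x s) <= kappa * (t - s)),
      (forall t, 0 <= t < T -> ~ stopped k (rho t) (theta t)) &
      {ae lebesgue_measure, forall t : R, 0 < t < T ->
        exists s, [/\ 0 <= s <= t, kappa * (t - s) <= delta &
          (upto k (x s) /\ is_derive t 1 rho kappa /\ is_derive t 1 theta 0)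
          \/
          (~ upto k (x s) /\
           exists2 v, is_derive t 1 x v &
             contour_velocity kappa k (rho t) (theta t) v)]}].

(* [l] is a limit value, as delta -> 0, of lengths of runs of the branch. *)
Definition branch_length (kappa : R) (k : nat) (sigma r0 l : R) : Prop :=
  forall e : R, 0 < e -> exists delta T (rho theta : R -> R),
    [/\ 0 < delta < e, 0 <= T,
        branch_run kappa k sigma r0 delta T rho theta &
        `|arc_length 0 T (fun t => polar (rho t) (theta t)) - l| < e].

(* The axis search goes straight from [xb] to [xu]. *)
Definition search_length (K : nat) (lenR lenL : nat -> R) : R :=
  L + \sum_(1 <= k < K) (lenR k + lenL k).

End Geometry.

(* Main.v *)
(* Along a branch the velocity lies between the outward radial direction and
   the tangent to the circle around the base station: the first because
   |theta| does not decrease, the second because on a level set of the cost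
   the distances to the user and to the base station cannot both grow.  Write
   x, y for the coordinates along and across the axis.  In the disc with
   diameter user-base station, where the stopping rule confines the run, this
   makes x + |y| grow at least at the speed of the vehicle, so that a branch
   has length at most (1 + sqrt 2) / 2 * L > 1.2 L.  Equality would require
   velocities parallel to the axes, which is possible only at y = 0, and
   x + |y| - y ^ 2 / (6 L) still grows at least at the speed of the vehicle;
   it varies between 0 and 1.2 L on the disc. *)

Require Import Defs.
From HB Require Import structures.
From mathcomp Require Import all_boot all_order all_algebra.
From mathcomp Require Import all_classical all_reals all_analysis.
From mathcomp Require Import ring lra.

Set Implicit Arguments.
Unset Strict Implicit.
Unset Printing Implicit Defensive.

Import Order.TTheory GRing.Theory Num.Theory.
Import numFieldNormedType.Exports.
Local Open Scope classical_set_scope.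
Local Open Scope ring_scope.

(** * Monotonicity from right derivatives known almost everywhere *)

(** Take the supremum of the times t with g 0 <= g t. The first hypothesis bounds how fast [g] can
    drop, so the supremum itself is such a time; the second one leads beyond it unless it equals
    [T]. *)
Lemma le_continuous_induction (R : realType) (g : R -> R) (M T : R) :
  0 <= T ->
  (forall s t, 0 <= s <= t -> t <= T -> g s <= g t + M * (t - s)) ->
  (forall t, 0 <= t < T -> \forall h \near 0^'+, g t <= g (t + h)) ->
  g 0 <= g T.
Proof.
move=> T0 gM gloc.
pose A := [set t | 0 <= t <= T /\ g 0 <= g t].
have A0 : A 0 by split=> //; rewrite lexx.
have supA : has_sup A by split; [exists 0|exists T => t [/andP[]]].
have supA0 : 0 <= sup A by apply: ub_le_sup => //; exact: supA.2.
have supAT : sup A <= T by apply: ge_sup; [exists 0|move=> t [/andP[]]].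
have gsup : g 0 <= g (sup A).
  apply/ler_addgt0Pr => e e0.
  have d0 : 0 < e / (`|M| + 1) by rewrite divr_gt0// ltr_wpDl.
  have [s [/andP[s0 sT] gs] ssup] := sup_adherent d0 supA.
  have sle : s <= sup A.
    by apply: ub_le_sup; [exact: supA.2|rewrite /A/= s0 sT].
  apply: (le_trans gs); apply: (le_trans (gM s (sup A) _ _)) => //.
    by rewrite s0.
  rewrite lerD2l; apply: (@le_trans _ _ ((`|M| + 1) * (e / (`|M| + 1)))).
    apply: (@le_trans _ _ ((`|M| + 1) * (sup A - s))).
      by apply: ler_wpM2r; [rewrite subr_ge0|rewrite ler_wpDr// ler_norm].
    by apply: ler_wpM2l; [rewrite addr_ge0|rewrite lerBlDr addrC -lerBlDr ltW].
  by rewrite mulrC divfK// gt_eqF// ltr_wpDl.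
have [->//|ne] := eqVneq T (sup A).
have sT : sup A < T by rewrite lt_neqAle eq_sym ne.
have := gloc (sup A); rewrite supA0 sT => /(_ isT) gl.
have : \forall h \near 0^'+, [/\ 0 < h, h < T - sup A & g (sup A) <= g (sup A + h)].
  have dT : 0 < T - sup A by rewrite subr_gt0.
  near=> h; split; near: h; [exact: nbhs_right_gt|exact: nbhs_right_lt|exact: gl].
move=> /filter_ex[h [h0 hT gh]].
have : sup A + h <= sup A.
  apply: ub_le_sup; first exact: supA.2.
  by split; [apply/andP; split; lra|exact: le_trans gh].
lra.
Unshelve. all: by end_near. Qed.

(** The velocity of a run is prescribed only almost everywhere, and this lemma integrates such
    information. The Lipschitz bound excludes functions that decrease on a null set, such as Cantor
    staircases. *)
Lemma ae_right_derive_ge0_le (R : realType) (g : R -> R) (M T : R) :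
  0 <= T ->
  (forall s t, 0 <= s <= t -> t <= T -> `|g t - g s| <= M * (t - s)) ->
  {ae lebesgue_measure, forall t : R, 0 < t < T ->
    exists2 l : R, 0 <= l & h^-1 * (g (t + h) - g t) @[h --> 0^'+] --> l} ->
  g 0 <= g T.
Proof.
move=> T0 gM [A [mA A0 sA]].
(* [g] is corrected by M1 times the measure of U `&` `[0, t], where U is a small
   open set containing the exceptional points, and by a small linear term: the
   sum increases to the right of every point. *)
apply/ler_addgt0Pr => e e0.
pose M1 := `|M| + 1.
have M10 : 0 < M1 by rewrite ltr_wpDl.
have MM1 : M <= M1 by rewrite ler_wpDr// ler_norm.
(* Nothing is assumed about the derivative at 0, so 0 joins the exceptional points. *)
pose B := A `|` [set (0 : R)].
have m0 : measurable [set (0 : R)] := measurable_set1 (0 : R).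
have mB : measurable B := measurableU _ _ mA m0.
have B0 : lebesgue_measure B = 0%E.
  by apply: null_set_setU => //; exact: lebesgue_measure_set1.
(* [U] exceeds the null set [B] by less than this measure, so the correction M1 * m costs at most e
   / 2; [eta] below is chosen so that the linear term costs at most the other half. *)
have d0 : 0 < e / 2 / M1 by rewrite !divr_gt0.
have [|U [oU BU muU]] := lebesgue_regularity_outer mB _ d0.
  by rewrite [ltLHS]B0.
have mU : measurable U by exact: measurable_realfun.open_measurable.
have {}muU : (lebesgue_measure U <= (e / 2 / M1)%:E)%E.
  rewrite -(setDUK BU).
  apply: (le_trans (measureU2 _ mB (measurableD mU mB))).
  by rewrite [X in (X + _)%E]B0 add0e ltW.
have le_mu (C D : set R) : measurable C -> measurable D -> C `<=` D ->
    (lebesgue_measure C <= lebesgue_measure D)%E.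
  by move=> mC mD CD; apply: le_measure; rewrite ?inE; [exact: mC|exact: mD|].
have muD (C D : set R) : measurable C -> measurable D -> C `&` D = set0 ->
    lebesgue_measure (C `|` D) = (lebesgue_measure C + lebesgue_measure D)%E.
  by move=> mC mD CD; apply: measureU.
pose V (t : R) : set R := U `&` `[0, t]%classic.
have mUt (t : R) : measurable (V t) by apply: measurableI.
have mUtle (t : R) : (lebesgue_measure (V t) <= (e / 2 / M1)%:E)%E.
  by apply: le_trans muU; apply: le_mu => //; exact: subIsetl.
have mUtfin (t : R) : lebesgue_measure (V t) \is a fin_num.
  by rewrite ge0_fin_numE// (le_lt_trans (mUtle t))// ltry.
pose m (t : R) := fine (lebesgue_measure (V t)).
have m_homo (s t : R) : s <= t -> m s <= m t.
  move=> st; rewrite fine_le//; apply: le_mu => //.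
  by apply: setIS => x /=; rewrite !in_itv/= => /andP[-> xs]; exact: le_trans st.
have m_incr (s t : R) : 0 <= s -> s < t -> `]s, t]%classic `<=` U -> m s + (t - s) <= m t.
  move=> s0 st stU.
  have mst : measurable (`]s, t]%classic : set R) by exact: measurable_itv.
  have -> : t - s = fine (lebesgue_measure (`]s, t]%classic : set R)).
    by rewrite lebesgue_measure_itv/= lte_fin st.
  have stfin : lebesgue_measure (`]s, t]%classic : set R) \is a fin_num.
    by rewrite lebesgue_measure_itv/= lte_fin st.
  rewrite -fineD//; apply: fine_le => //; first by rewrite fin_numD mUtfin.
  rewrite -muD//; last first.
    rewrite -subset0 => x [] [_ /=]; rewrite !in_itv/=.
    by move=> /andP[_ xs] /andP[]; rewrite ltNge xs.
  apply: le_mu => //; first exact: measurableU.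
  move=> x [[Ux xs]|xst].
    split=> //; move: xs; rewrite /= !in_itv/= => /andP[-> xs] /=.
    exact: le_trans (ltW st).
  split; first exact: stU.
  by move: xst; rewrite /= !in_itv/= => /andP[/ltW/(le_trans s0) -> ->].
pose eta := e / 2 / (T + 1).
have eta0 : 0 < eta by rewrite !divr_gt0// ltr_wpDl.
pose g1 (t : R) := g t + M1 * m t + eta * t.
have gN (s t : R) : 0 <= s <= t -> t <= T -> g s <= g t + M1 * (t - s).
  move=> st tT; have := gM s t st tT; rewrite ler_norml => /andP[+ _].
  have := ler_wpM2r _ MM1 => /(_ (t - s)); rewrite subr_ge0.
  by case/andP : st => _ st /(_ st); lra.
suff : g1 0 <= g1 T.
  have mT : M1 * m T <= e / 2.
    rewrite -ler_pdivlMl// mulrC.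
    by rewrite -lee_fin fineK.
  have Mm0 : 0 <= M1 * m 0 by rewrite mulr_ge0 ?fine_ge0// ltW.
  have eT : eta * T <= e / 2.
    rewrite /eta mulrAC ler_pdivrMr ?ltr_wpDl//.
    by apply: ler_wpM2l; lra.
  by rewrite /g1 mulr0; lra.
apply: (@le_continuous_induction _ g1 M1 T T0).
  move=> s t st tT; rewrite /g1.
  have := gN s t st tT; case/andP: st => s0 st.
  have := ler_wpM2l (ltW M10) (m_homo _ _ st).
  have := ler_wpM2l (ltW eta0) st. lra.
move=> t /andP[t0 tT].
(* Inside [U] the measure grows at unit rate to the right, and M1 times it outweighs any loss of
   [g]. Outside [U] the right derivative is nonnegative and the slope [eta] absorbs the error
   term. *)
have [Ut|nUt] := pselect (U t).
  have : \forall h \near 0^'+, `]t, t + h]%classic `<=` U.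
    have [r/= r0 rU] : nbhs t U by exact: open_nbhs_nbhs.
    near=> h => x /=; rewrite in_itv/= => /andP[tx xh].
    apply: rU => /=; rewrite ltr_norml; apply/andP; split; last by lra.
    have : h < r by near: h; exact: nbhs_right_lt.
    lra.
  move=> hU; near=> h.
  have h0 : 0 < h by [].
  have hT : t + h <= T.
    rewrite -lerBrDl; near: h; apply: nbhs_right_le; lra.
  have := gN t (t + h) _ hT; rewrite t0 lerDl ltW// => /(_ isT).
  have := m_incr t (t + h) t0; rewrite ltrDl h0 => /(_ isT) mi.
  have /mi : `]t, t + h]%classic `<=` U by near: h.
  rewrite -(ler_pM2l M10) /g1 => ?.
  have : 0 < eta * h by rewrite mulr_gt0.
  lra.
have tgt0 : 0 < t.
  rewrite lt_neqAle t0 andbT; apply/eqP => t00; apply: nUt; apply: BU.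
  by right.
have [l l0 gl] : exists2 l : R, 0 <= l & h^-1 * (g (t + h) - g t) @[h --> 0^'+] --> l.
  apply: contrapT => H; apply: nUt; apply: BU; left; apply: sA => /=.
  by move/(_ _); rewrite tgt0 tT => /(_ isT).
have /(cvgr_gt _ gl) : - eta < l by lra.
move=> gl'; near=> h.
have h0 : 0 < h by [].
have : - eta < h^-1 * (g (t + h) - g t) by near: h.
rewrite -(ltr_pM2l h0) mulVKf ?gt_eqF// /g1 => ?.
have : M1 * m t <= M1 * m (t + h) by rewrite ler_pM2l// m_homo// lerDl ltW.
lra.
Unshelve. all: by end_near. Qed.

(** * Orthonormal frame adapted to the axis *)

Section Frame.
Variables (R : realType) (S : scenario R).

(* Coordinates along the axis from the user to the base station, and across it. *)
Definition along (w : 'cV[R]_2) : R :=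
  w 0 0 * axis S 0 0 + w 1 0 * axis S 1 0.
Definition across (w : 'cV[R]_2) : R :=
  w 1 0 * axis S 0 0 - w 0 0 * axis S 1 0.

Lemma sqr_enorm (w : 'cV[R]_2) : enorm w ^+ 2 = w 0 0 ^+ 2 + w 1 0 ^+ 2.
Proof.
rewrite /enorm sqr_sqrtr ?sumr_ge0// => [|i _]; last exact: sqr_ge0.
by rewrite big_ord_recl big_ord1; congr (_ + w _ _ ^+ 2); apply: val_inj.
Qed.

Lemma enorm_ge0 (w : 'cV[R]_2) : 0 <= enorm w.
Proof. exact: sqrtr_ge0. Qed.

Lemma alongZ c (w : 'cV[R]_2) : along (c *: w) = c * along w.
Proof. by rewrite /along !mxE; ring. Qed.
Lemma alongD (w z : 'cV[R]_2) : along (w + z) = along w + along z.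
Proof. by rewrite /along !mxE; ring. Qed.
Lemma alongB (w z : 'cV[R]_2) : along (w - z) = along w - along z.
Proof. by rewrite /along !mxE; ring. Qed.
Lemma acrossZ c (w : 'cV[R]_2) : across (c *: w) = c * across w.
Proof. by rewrite /across !mxE; ring. Qed.
Lemma acrossD (w z : 'cV[R]_2) : across (w + z) = across w + across z.
Proof. by rewrite /across !mxE; ring. Qed.
Lemma acrossB (w z : 'cV[R]_2) : across (w - z) = across w - across z.
Proof. by rewrite /across !mxE; ring. Qed.

Hypothesis bu : xb S != xu S.

Lemma L_gt0 : 0 < L S.
Proof.
rewrite lt_neqAle enorm_ge0 andbT eq_sym; apply: contra bu => /eqP L0.
have := sqr_enorm (xb S - xu S); rewrite -/(L S) L0 expr0n/=.
move=> /esym/eqP; rewrite paddr_eq0 ?sqr_ge0// !sqrf_eq0 => /andP[/eqP e0 /eqP e1].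
rewrite -subr_eq0; move: (xb S - xu S) e0 e1 => w e0 e1.
apply/eqP/matrixP => i j; rewrite (ord1 j) [RHS]mxE.
by case: i => -[|[|//]] i2; [rewrite -[RHS]e0|rewrite -[RHS]e1];
  congr (w _ _); apply: val_inj.
Qed.

Lemma axisE : xb S - xu S = L S *: axis S.
Proof. by rewrite /axis scalerA divff ?scale1r// gt_eqF// L_gt0. Qed.

Lemma axis_unit : axis S 0 0 ^+ 2 + axis S 1 0 ^+ 2 = 1.
Proof.
have axisi i : axis S i 0 = (L S)^-1 * (xb S - xu S) i 0 by rewrite /axis mxE.
rewrite !axisi !exprMn -mulrDr -sqr_enorm -/(L S) -exprMn mulVf ?expr1n//.
by rewrite gt_eqF// L_gt0.
Qed.

Lemma sqr_enorm_frame (w : 'cV[R]_2) :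
  enorm w ^+ 2 = along w ^+ 2 + across w ^+ 2.
Proof.
rewrite sqr_enorm -[LHS]mulr1 -axis_unit /along /across; ring.
Qed.

Lemma along_le (w : 'cV[R]_2) : `|along w| <= enorm w.
Proof.
rewrite -(ler_pXn2r (n:=2)) ?nnegrE ?enorm_ge0// sqr_enorm_frame.
by rewrite real_normK ?num_real// lerDl sqr_ge0.
Qed.

Lemma across_le (w : 'cV[R]_2) : `|across w| <= enorm w.
Proof.
rewrite -(ler_pXn2r (n:=2)) ?nnegrE ?enorm_ge0// sqr_enorm_frame.
by rewrite real_normK ?num_real// lerDr sqr_ge0.
Qed.

Let mulmx2 (A : 'M[R]_2) (w : 'cV[R]_2) i :
  (A *m w) i 0 = A i 0 * w 0 0 + A i 1 * w 1 0.
Proof.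
rewrite mxE big_ord_recl big_ord1.
by congr (_ + A _ _ * w _ _); apply: val_inj.
Qed.

Lemma along_rot t : along (rotmx t *m axis S) = cos t.
Proof.
rewrite -[RHS]mulr1 -axis_unit /along !mulmx2 !mxE/=; ring.
Qed.
Lemma across_rot t : across (rotmx t *m axis S) = sin t.
Proof.
rewrite -[RHS]mulr1 -axis_unit /across !mulmx2 !mxE/=; ring.
Qed.
Lemma along_drot t : along (drotmx t *m axis S) = - sin t.
Proof.
rewrite -[RHS]mulr1 -axis_unit /along !mulmx2 !mxE/=; ring.
Qed.
Lemma across_drot t : across (drotmx t *m axis S) = cos t.
Proof.
rewrite -[RHS]mulr1 -axis_unit /across !mulmx2 !mxE/=; ring.
Qed.

Lemma along_polar r t : along (polar S r t - xu S) = r * cos t.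
Proof. by rewrite /polar addrC addKr alongZ along_rot. Qed.
Lemma across_polar r t : across (polar S r t - xu S) = r * sin t.
Proof. by rewrite /polar addrC addKr acrossZ across_rot. Qed.

(** With the user as origin, the base station has coordinates (L, 0). *)
Lemma sqr_dist_xb (z : 'cV[R]_2) : enorm (z - xb S) ^+ 2 =
  (along (z - xu S) - L S) ^+ 2 + across (z - xu S) ^+ 2.
Proof.
have -> : z - xb S = (z - xu S) - L S *: axis S.
  by rewrite -axisE opprB addrA addrNK.
move: (z - xu S) => {}z; rewrite sqr_enorm_frame alongB acrossB alongZ acrossZ.
have -> : along (axis S) = 1 by rewrite -axis_unit /along; ring.
have -> : across (axis S) = 0 by rewrite /across; ring.
by rewrite mulr1 mulr0 subr0.
Qed.

End Frame.

(** * Distances to user and base station, and level sets of the cost *)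

Lemma ler_powRN (R : realType) (a x y : R) :
  0 <= a -> 0 < x -> x <= y -> y `^ (- a) <= x `^ (- a).
Proof.
move=> a0 x0 xy; have y0 := lt_le_trans x0 xy.
rewrite !powRN lef_pV2 ?posrE ?powR_gt0//.
by apply: ge0_ler_powR; rewrite ?nnegrE// ltW.
Qed.

(** Twice the quantity assumed positive is the right derivative at 0 of the squared distance to the
    point (m, 0). It serves with m = 0 for the user and m = L for the base station. *)
Lemma ltr_sqr_of_rate (R : realType) (A B : R -> R) (p q m : R) :
  s^-1 * (A s - A 0) @[s --> 0^'+] --> p ->
  s^-1 * (B s - B 0) @[s --> 0^'+] --> q ->
  0 < p * (A 0 - m) + q * B 0 ->
  \forall s \near 0^'+, (A 0 - m) ^+ 2 + B 0 ^+ 2 < (A s - m) ^+ 2 + B s ^+ 2.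
Proof.
move=> Ap Bq pq0.
have cvgid : (s : R) @[s --> 0^'+] --> 0 by apply: cvg_within.
(* This is the difference quotient of the squared distance, factored as a difference of squares.
   Writing each increment as s times its rate makes the limit follow from the rates alone. *)
have : (s^-1 * (A s - A 0)) * (2 * (A 0 - m) + s * (s^-1 * (A s - A 0))) +
       (s^-1 * (B s - B 0)) * (2 * B 0 + s * (s^-1 * (B s - B 0)))
       @[s --> 0^'+] --> p * (2 * (A 0 - m) + 0 * p) + q * (2 * B 0 + 0 * q).
  apply: cvgD; apply: cvgM => //; apply: cvgD; try exact: cvg_cst;
    by apply: cvgM.
move=> /cvgr_gt/(_ 0); case: (ltP 0 _) => [_ /(_ isT) H|]; last by lra.
near=> s.
have s0 : 0 < s by [].
have : 0 < (s^-1 * (A s - A 0)) * (2 * (A 0 - m) + s * (s^-1 * (A s - A 0))) +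
       (s^-1 * (B s - B 0)) * (2 * B 0 + s * (s^-1 * (B s - B 0))).
  by near: s.
rewrite -(pmulr_rgt0 _ s0) mulrDr !mulrA !divff ?gt_eqF// !mul1r => H1.
rewrite -subr_gt0; apply: (lt_le_trans H1).
by rewrite le_eqVlt; apply/orP; left; apply/eqP; ring.
Unshelve. all: by end_near. Qed.

Lemma sqr_inward_le (R : realFieldType) (r h : R) :
  - r < h -> h < 0 -> (r + h) ^+ 2 <= r ^+ 2.
Proof. move=> hr h0; rewrite -subr_ge0. nra. Qed.

(** By the law of cosines, with c the cosine of the polar angle, these are squared distances to the
    base station. A step of length -h towards the user increases them by at most 2 * l * (-h). *)
Lemma sqr_inward_xb_le (R : realFieldType) (r h l c gap : R) :
  - r < h -> h < 0 -> 0 < l -> c <= 1 -> - h * (2 * l) < gap ->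
  (r + h) ^+ 2 - 2 * (r + h) * l * c + l ^+ 2 <=
  r ^+ 2 - 2 * r * l * c + l ^+ 2 + gap.
Proof.
move=> hr h0 l0 c1 hg.
have := sqr_inward_le hr h0.
have : 0 <= - h * l * (1 - c) by rewrite !mulr_ge0 ?subr_ge0// ?oppr_ge0 ltW.
lra.
Qed.

Section Contour.
Variables (R : realType) (S : scenario R) (K : nat).
Hypothesis hS : standing_assumptions S K.

Let bu := xb_neq_xu hS.

Lemma db_gt0 z : 0 < db S z.
Proof.
rewrite sqrtr_gt0 ltr_wpDl ?sqr_ge0// exprn_gt0// subr_gt0.
exact: Hb_lt_Hd hS.
Qed.

Lemma du_gt0 z : 0 < du S z.
Proof.
rewrite sqrtr_gt0 ltr_wpDl ?sqr_ge0// exprn_gt0// subr_gt0.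
exact: Hu_lt_Hd hS.
Qed.

Lemma gb_gt0 z : 0 < gb S z.
Proof. by rewrite mulr_gt0 ?powR_gt0 ?db_gt0// (beta_gt0 hS). Qed.

Lemma gu_gt0 k z : (k <= K)%N -> 0 < gu S k z.
Proof. by move=> kK; rewrite mulr_gt0 ?powR_gt0 ?du_gt0// (beta_gt0 hS). Qed.

Lemma gb_le z z' : enorm (z - xb S) ^+ 2 <= enorm (z' - xb S) ^+ 2 ->
  gb S z' <= gb S z.
Proof.
move=> zz'; rewrite ler_pM2l ?(beta_gt0 hS)//.
apply: ler_powRN; [|exact: db_gt0|].
  exact/ltW/(lt_trans ltr01)/(alpha_gt1 hS).
by rewrite ler_wsqrtr// lerD2r.
Qed.

Lemma gu_le k z z' : (k <= K)%N ->
  enorm (z - xu S) ^+ 2 <= enorm (z' - xu S) ^+ 2 -> gu S k z' <= gu S k z.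
Proof.
move=> kK zz'; rewrite /gu ler_pM2l ?(beta_gt0 hS kK)//.
apply: ler_powRN; [|exact: du_gt0|].
  exact/ltW/(lt_trans ltr01)/(alpha_gt1 hS kK).
by rewrite ler_wsqrtr// lerD2r.
Qed.

Lemma costk_le k z z' : (k <= K)%N ->
  enorm (z - xu S) ^+ 2 <= enorm (z' - xu S) ^+ 2 ->
  enorm (z - xb S) ^+ 2 <= enorm (z' - xb S) ^+ 2 ->
  costk S k z <= costk S k z'.
Proof.
move=> kK zu zb; apply: (@le_trans _ _ (cost S (gu S k z', gb S z))).
  exact: (cost_decr1 hS (gu_gt0 z' kK) (gu_le kK zu) (gb_gt0 z)).
exact: (cost_decr2 hS (gu_gt0 z' kK) (gb_gt0 z') (gb_le zb)).
Qed.

Lemma sqr_polar_xu r t : enorm (polar S r t - xu S) ^+ 2 = r ^+ 2.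
Proof.
by rewrite (sqr_enorm_frame bu) (along_polar bu) (across_polar bu) !exprMn -mulrDr cos2Dsin2 mulr1.
Qed.

Lemma sqr_polar_xb r t : enorm (polar S r t - xb S) ^+ 2 =
  r ^+ 2 - 2 * r * L S * cos t + L S ^+ 2.
Proof.
rewrite (sqr_dist_xb bu) (along_polar bu) (across_polar bu).
rewrite [X in _ + X]exprMn sin2cos2; ring.
Qed.

(** On a circle around the user only the distance to the base station varies, and it does not
    increase with the cosine of the angle. *)
Lemma F_le_cos k r t t' : (k <= K)%N -> 0 <= r -> cos t' <= cos t ->
  F S k r t <= F S k r t'.
Proof.
move=> kK r0 tt'; apply: costk_le; rewrite ?sqr_polar_xu ?sqr_polar_xb//.
rewrite lerD2r lerD2l lerN2 ler_wpM2l//.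
by rewrite !mulr_ge0// ltW// (L_gt0 bu).
Qed.

(** Turning away from the axis cannot lower the cost, so [F] is monotone in the angle near t, in the
    direction given by the sign of sin t. *)
Lemma lderive_angle_sign k r t d : (k <= K)%N -> 0 <= r ->
  is_lderive (fun s => F S k r s) t d -> 0 <= d * sin t.
Proof.
move=> kK r0 Fd.
(* The product form shows the sign of cos (t + s) - cos t for small s < 0. *)
have cosB2 (s : R) : cos (t + s) = cos t - 2 * sin (t + s / 2) * sin (s / 2).
  have {1}-> : t + s = (t + s / 2) + s / 2 by field.
  have {2}-> : t = (t + s / 2) - s / 2 by field.
  rewrite cosD cosB; ring.
have sins2 : \forall s \near 0^'-, sin (s / 2) <= (0 : R).
  near=> s.
  have s0 : s < 0 by near: s; exact: nbhs_left_lt.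
  have s1 : - pi < s by near: s; apply: nbhs_left_gt; rewrite oppr_lt0 pi_gt0.
  rewrite -oppr_ge0 -sinN; apply: sin_ge0_pi; apply/andP; split; lra.
have sint : sin (t + s / 2) @[s --> 0^'-] --> sin t.
  have {2}-> : t = t + 0 / 2 by rewrite mul0r addr0.
  apply: (@cvg_comp _ _ _ (fun s => t + s / 2) sin _ (nbhs (t + 0 / 2))); last exact: continuous_sin.
  by apply: cvg_within_filter; apply: cvgD; [exact: cvg_cst|apply: cvgMl; exact: cvg_id].
have [st|st|<-] := ltgtP 0 (sin t); last by rewrite mulr0.
- rewrite mulr_ge0 ?(ltW st)//.
  apply: (cvgr_to_ge Fd); near=> s.
  have s0 : s < 0 by near: s; exact: nbhs_left_lt.
  rewrite nmulr_rge0 ?invr_lt0// subr_le0; apply: F_le_cos => //.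
  rewrite cosB2 lerDl oppr_ge0 mulr_ge0_le0//; last by near: s.
  by rewrite mulr_ge0// ltW//; near: s; exact: (cvgr_gt _ sint).
- rewrite mulr_le0 ?(ltW st)//.
  apply: (cvgr_to_le Fd); near=> s.
  have s0 : s < 0 by near: s; exact: nbhs_left_lt.
  rewrite nmulr_rle0 ?invr_lt0// subr_ge0; apply: F_le_cos => //.
  rewrite cosB2 gerDl oppr_le0 mulr_le0//; last by near: s.
  by rewrite mulr_ge0_le0// ltW//; near: s; exact: (cvgr_lt _ sint).
Unshelve. all: by end_near. Qed.

Lemma rate_along (w : R -> 'cV[R]_2) v : s^-1 *: (w s - w 0) @[s --> 0^'+] --> v ->
  s^-1 * (along S (w s - xu S) - along S (w 0 - xu S)) @[s --> 0^'+] --> along S v.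
Proof.
move=> wv.
have coord i : (s^-1 *: (w s - w 0)) i 0 @[s --> 0^'+] --> v i 0.
  exact: (@cvg_comp _ _ _ _ (fun M : 'cV[R]_2 => M i 0) _ _ _ wv (@coord_continuous R 2 1 i 0 v)).
rewrite (_ : (fun s => _) = (fun s => along S (s^-1 *: (w s - w 0)))).
  by apply: cvgD; apply: cvgMl; exact: coord.
by apply/funext => s; rewrite alongZ !alongB; ring.
Qed.

Lemma rate_across (w : R -> 'cV[R]_2) v : s^-1 *: (w s - w 0) @[s --> 0^'+] --> v ->
  s^-1 * (across S (w s - xu S) - across S (w 0 - xu S)) @[s --> 0^'+] --> across S v.
Proof.
move=> wv.
have coord i : (s^-1 *: (w s - w 0)) i 0 @[s --> 0^'+] --> v i 0.
  exact: (@cvg_comp _ _ _ _ (fun M : 'cV[R]_2 => M i 0) _ _ _ wv (@coord_continuous R 2 1 i 0 v)).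
rewrite (_ : (fun s => _) = (fun s => across S (s^-1 *: (w s - w 0)))).
  by apply: cvgB; apply: cvgMl; exact: coord.
by apply/funext => s; rewrite acrossZ !acrossB; ring.
Qed.

(* The cost decreases only weakly, so two growing distances do not contradict
   the constancy of F_k by themselves; but d < 0 makes F_k strictly larger at
   radially inward points, which are nearer to the user, and still nearer to
   the base station than the far end of the arc. *)
Lemma level_arc_rate k (c : R -> 'cV[R]_2) r t d v : (k <= K)%N -> 0 < r ->
  is_lderive (fun r' => F S k r' t) r d -> d < 0 ->
  c 0 = polar S r t ->
  s^-1 *: (c s - c 0) @[s --> 0^'+] --> v ->
  (\forall s \near 0^'+, costk S k (c s) = costk S k (c 0)) ->
  0 < r * (along S v * cos t + across S v * sin t) ->
  along S v * (r * cos t - L S) + across S v * (r * sin t) <= 0.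
Proof.
have quot (h a b : R) : h < 0 -> h^-1 * (a - b) < 0 -> b < a.
  by move=> h0; rewrite nmulr_rlt0 ?invr_lt0// subr_gt0.
move=> kK r0 Fd d0 c0 cv clev vu; rewrite leNgt; apply/negP => vb.
have Ap := rate_along cv; have Bq := rate_across cv.
have A0 : along S (c 0 - xu S) = r * cos t by rewrite c0 (along_polar bu).
have B0 : across S (c 0 - xu S) = r * sin t by rewrite c0 (across_polar bu).
(* Under the negated conclusion both squared distances grow along the arc: [m] is L in [farb] and 0
   in [faru]. *)
have := ltr_sqr_of_rate Ap Bq; rewrite A0 B0 => far.
have farb := far _ vb.
have {far}faru := far 0 _.
have [s [lev bs us]] : exists s, [/\ costk S k (c s) = costk S k (c 0),
    enorm (c 0 - xb S) ^+ 2 < enorm (c s - xb S) ^+ 2 &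
    enorm (c 0 - xu S) ^+ 2 < enorm (c s - xu S) ^+ 2].
  apply: (@filter_ex _ (0^'+)); near=> s; split; first by near: s.
    by rewrite !(sqr_dist_xb bu) A0 B0; near: s.
  rewrite !(sqr_enorm_frame bu) A0 B0.
  have : (r * cos t - 0) ^+ 2 + (r * sin t) ^+ 2 <
    (along S (c s - xu S) - 0) ^+ 2 + across S (c s - xu S) ^+ 2.
    near: s; apply: faru; move: vu; lra.
  by rewrite !subr0.
pose gap := enorm (c s - xb S) ^+ 2 - enorm (c 0 - xb S) ^+ 2.
have gap0 : 0 < gap by rewrite subr_gt0.
have L0 := L_gt0 bu.
have L20 : 0 < 2 * L S by rewrite mulr_gt0.
(* The bound gap / (2 L) on the inward step keeps the growth of the squared distance to the base
   station below [gap]. The inward point is then no farther from either station than c s, while d <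
   0 makes its cost strictly larger than that of c s. *)
have [h [h0 hr hgap]] : exists h, [/\ h < 0, - r < h /\ - (gap / (2 * L S)) < h & F S k r t < F S k (r + h) t].
  apply: (@filter_ex _ (0^'-)); near=> h.
  have h0 : h < 0 by near: h; exact: nbhs_left_lt.
  split; [exact: h0|split|].
  - by near: h; apply: nbhs_left_gt; rewrite oppr_lt0.
  - by near: h; apply: nbhs_left_gt; rewrite oppr_lt0 divr_gt0.
  have : h^-1 * (F S k (r + h) t - F S k r t) < 0 by near: h; exact: (cvgr_lt _ Fd).
  exact: quot h0.
move: hgap; apply/negP; rewrite -leNgt /F.
rewrite -c0 -lev; case: hr => hr hg.
have {}hg : - h * (2 * L S) < gap.
  rewrite -(ltr_pdivlMr _ _ L20) ltrNl; exact: hg.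
apply: (costk_le kK).
  apply: le_trans (ltW us).
  by rewrite c0 !sqr_polar_xu; exact: (sqr_inward_le hr h0).
have -> : enorm (c s - xb S) ^+ 2 = enorm (c 0 - xb S) ^+ 2 + gap.
  by rewrite /gap [RHS]addrC subrK.
by rewrite c0 !sqr_polar_xb; exact: (sqr_inward_xb_le hr h0 L0 (cos_le1 t) hg).
Unshelve. all: by end_near. Qed.

End Contour.

(** * The potential on the disc: range, growth and regularity *)

Section Potential.
Variables (R : realType) (l : R).

(** The square is taken of [|y|], so that generalizing the absolute value leaves a polynomial in two
    variables. *)
Definition potential (x y : R) : R := x + `|y| - `|y| ^+ 2 / (6 * l).

(** The hypothesis describes the disc of radius l / 2 centred at (l / 2, 0). *)
Lemma disc_abs_le (x y : R) : 0 < l -> x ^+ 2 + y ^+ 2 <= l * x -> `|y| <= l / 2.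
Proof.
move=> l0 xy; rewrite -(ler_pXn2r (n:=2)) ?nnegrE//; last by rewrite divr_ge0// ltW.
rewrite real_normK ?num_real// -subr_ge0.
have -> : (l / 2) ^+ 2 - y ^+ 2 = (l * x - (x ^+ 2 + y ^+ 2)) + (x - l / 2) ^+ 2.
  by field.
by rewrite addr_ge0 ?sqr_ge0// subr_ge0.
Qed.

Lemma potential_ge0 (x y : R) : 0 < l -> 0 <= x -> `|y| <= l / 2 -> 0 <= potential x y.
Proof.
move=> l0 x0 yl; rewrite /potential -addrA addr_ge0// subr_ge0.
rewrite ler_pdivrMr ?mulr_gt0// expr2 ler_wpM2l//; apply: (le_trans yl); lra.
Qed.

Lemma potential_le (x y : R) : 0 < l -> x ^+ 2 + y ^+ 2 <= l * x ->
  potential x y <= 12 / 10 * l.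
Proof.
move=> l0 xy; rewrite -(ler_pM2l l0) /potential.
have -> : l * (x + `|y| - `|y| ^+ 2 / (6 * l)) = l * x + l * `|y| - `|y| ^+ 2 / 6.
  by field; rewrite gt_eqF.
move: xy; rewrite -(real_normK (num_real y)); move: `|y| => z xy.
rewrite -subr_ge0.
(* The disc constraint enters with multiplier 4 / 3 and the rest is a sum of squares. The last term
   is the slack between 19 / 16, which this argument would give, and 12 / 10. *)
have -> : l * (12 / 10 * l) - (l * x + l * z - z ^+ 2 / 6) =
   4 / 3 * (l * x - (x ^+ 2 + z ^+ 2)) + 4 / 3 * (x - 7 / 8 * l) ^+ 2
   + 3 / 2 * (z - l / 3) ^+ 2 + l ^+ 2 / 80.
  by field.
by rewrite !addr_ge0 ?divr_ge0 ?sqr_ge0// mulr_ge0 ?sqr_ge0 ?subr_ge0.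
Qed.

(* Applied to the velocity (p, q) at the point (x, y) and the speed c. *)
Lemma potential_rate_ge (x y p q c : R) : 0 < l -> 0 <= x < l ->
  x ^+ 2 + y ^+ 2 <= l * x -> 0 <= c -> p ^+ 2 + q ^+ 2 = c ^+ 2 ->
  0 <= y * q -> y * q <= p * (l - x) ->
  c <= p + `|q| * (1 - `|y| / (3 * l)).
Proof.
move=> l0 /andP[x0 xl] xy c0 pqc yq0 yqp.
have p0 : 0 <= p by rewrite -(pmulr_lge0 _ (_ : 0 < l - x)) ?subr_gt0//; lra.
have zw : `|y| * `|q| = y * q by rewrite -normrM ger0_norm.
have zl := disc_abs_le l0 xy.
have {}pqc : p ^+ 2 + `|q| ^+ 2 = c ^+ 2 by rewrite real_normK ?num_real.
(* Since p x >= 0, the last hypothesis gives y q <= p l. *)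
have pl : `|y| / l * `|q| <= p.
  rewrite mulrAC ler_pdivrMr// zw (le_trans yqp)// mulrBr gerBl.
  by rewrite mulr_ge0.
have -> : `|y| / (3 * l) = (`|y| / l) / 3 by field; rewrite gt_eqF.
have {zl}zeta1 : `|y| / l <= 1 / 2 by rewrite ler_pdivrMr// mulrC mulrA mulr1.
have zeta0 : 0 <= `|y| / l by rewrite divr_ge0// ltW.
have q0 := normr_ge0 q.
move: (`|y| / l) (`|q|) zeta0 zeta1 q0 pqc pl => z w z0 z1 w0 pqc pl.
rewrite -(ler_pXn2r (n:=2)) ?nnegrE//; last first.
  by rewrite addr_ge0// mulr_ge0//; lra.
rewrite -pqc -subr_ge0.
(* Each term is nonnegative: the second by [pl], the third because z <= 1 / 2 on the disc. *)
have -> : (p + w * (1 - z / 3)) ^+ 2 - (p ^+ 2 + w ^+ 2) =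
   p * w + 2 / 3 * (w * (p - z * w)) + 2 / 3 * (p * w * (1 / 2 - z)) + (w * z / 3) ^+ 2.
  by field.
by rewrite !addr_ge0 ?sqr_ge0// !mulr_ge0// ?subr_ge0.
Qed.

(** The absolute value may have a kink at 0, but the sign condition gives |y + h q| = |y| + h |q|
    for h > 0. The reverse triangle inequality then transfers the rate of [Y] to its absolute
    value. *)
Lemma cvg_rate_abs (Y : R -> R) (t q : R) :
  h^-1 * (Y (t + h) - Y t) @[h --> 0^'+] --> q -> 0 <= Y t * q ->
  h^-1 * (`|Y (t + h)| - `|Y t|) @[h --> 0^'+] --> `|q|.
Proof.
move=> Yq yq0; apply/cvgrPdist_lt => e e0.
move/cvgrPdist_lt : (Yq) => /(_ e e0) Yqe.
near=> h.
have h0 : 0 < h by [].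
have : `|q - h^-1 * (Y (t + h) - Y t)| < e by near: h.
apply: le_lt_trans.
have yhq : `|Y t + h * q| = `|Y t| + h * `|q|.
  have [y0|y0|y0] := ltgtP 0 (Y t).
  - have q0 : 0 <= q by rewrite pmulr_rge0 in yq0.
    by rewrite !ger0_norm// ?addr_ge0 ?mulr_ge0// ltW.
  - have q0 : q <= 0 by rewrite nmulr_rge0 in yq0.
    rewrite !ler0_norm// ?(ltW y0)//; first by ring.
    by rewrite -oppr_ge0 opprD addr_ge0 ?oppr_ge0 ?(ltW y0)// mulr_ge0_le0// ltW.
  - by rewrite -y0 normr0 !add0r normrM gtr0_norm.
have -> : `|q| - h^-1 * (`|Y (t + h)| - `|Y t|) =
    h^-1 * (`|Y t + h * q| - `|Y (t + h)|).
  by rewrite yhq; field; rewrite gt_eqF.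
have -> : q - h^-1 * (Y (t + h) - Y t) = h^-1 * (Y t + h * q - Y (t + h)).
  by field; rewrite gt_eqF.
rewrite !normrM; apply: ler_wpM2l => //; exact: ler_dist_dist.
Unshelve. all: by end_near. Qed.

Lemma cvg_rate_potential (X Y : R -> R) (t p q : R) :
  0 < l ->
  h^-1 * (X (t + h) - X t) @[h --> 0^'+] --> p ->
  h^-1 * (Y (t + h) - Y t) @[h --> 0^'+] --> q -> 0 <= Y t * q ->
  h^-1 * (potential (X (t + h)) (Y (t + h)) - potential (X t) (Y t))
    @[h --> 0^'+] --> p + `|q| * (1 - `|Y t| / (3 * l)).
Proof.
move=> l0 Xp Yq yq0; have Zq := cvg_rate_abs Yq yq0.
have cvgid : (h : R) @[h --> 0^'+] --> 0 by apply: cvg_within.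
have -> : p + `|q| * (1 - `|Y t| / (3 * l)) =
    p + `|q| * (1 - (2 * `|Y t| + 0 * `|q|) / (6 * l)).
  by field; rewrite gt_eqF.
have H : h^-1 * (X (t + h) - X t) + h^-1 * (`|Y (t + h)| - `|Y t|) *
    (1 - (2 * `|Y t| + h * (h^-1 * (`|Y (t + h)| - `|Y t|))) / (6 * l))
  @[h --> 0^'+] --> p + `|q| * (1 - (2 * `|Y t| + 0 * `|q|) / (6 * l)).
  apply: cvgD => //; apply: cvgM => //.
  apply: cvgB; first exact: cvg_cst.
  apply: cvgMl; apply: cvgD; first exact: cvg_cst.
  exact: cvgM.
apply: cvg_trans H; apply: near_eq_cvg; near=> h.
have h0 : h != 0 by rewrite gt_eqF.
by rewrite /potential mulVKf//; field; rewrite h0 gt_eqF.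
Unshelve. all: by end_near. Qed.

Lemma potential_lipschitz (x y x' y' d : R) :
  0 < l ->
  `|y| <= l / 2 -> `|y'| <= l / 2 -> `|x' - x| <= d -> `|y' - y| <= d ->
  `|potential x' y' - potential x y| <= 3 * d.
Proof.
move=> l0 yl yl' xd yd.
have zd : `| `|y'| - `|y| | <= d := le_trans (ler_dist_dist _ _) yd.
have z0 := normr_ge0 y; have z'0 := normr_ge0 y'.
rewrite /potential.
move: (`|y'|) (`|y|) yl yl' zd z0 z'0 => z' z yl yl' zd z0 z'0.
(* The second factor lies between 0 and 1, so 2 * d would already do. *)
have -> : x' + z' - z' ^+ 2 / (6 * l) - (x + z - z ^+ 2 / (6 * l)) =
  (x' - x) + (z' - z) * (1 - (z' + z) / (6 * l)) by field; rewrite gt_eqF.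
apply: (le_trans (ler_normD _ _)).
have : `|1 - (z' + z) / (6 * l)| <= 1.
  have : (z' + z) / (6 * l) <= 1 by rewrite ler_pdivrMr ?mulr_gt0//; lra.
  have : 0 <= (z' + z) / (6 * l) by rewrite divr_ge0 ?addr_ge0// mulr_ge0// ltW.
  by rewrite ler_norml => ? ?; apply/andP; split; lra.
rewrite normrM => /(ler_wpM2l (normr_ge0 (z' - z))); rewrite mulr1.
have := le_trans (normr_ge0 _) xd.
lra.
Qed.

End Potential.

(** * Velocities under the two rules of motion *)

Lemma is_derive_rate (R : realType) (V : normedModType R) (f : R -> V) (t : R) (d : V) :
  is_derive t 1 f d -> h^-1 *: (f (t + h) - f t) @[h --> 0^'+] --> d.
Proof.
move=> [fd <-]; apply: cvg_dnbhs_at_right.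
rewrite (_ : (fun h => _) = (fun h => h^-1 *: ((f \o shift t) (h *: 1) - f t))).
  exact: fd.
by apply/funext => h; rewrite /= [h *: 1]mulr1 [h + t]addrC.
Qed.

Section Run.
Variables (R : realType) (S : scenario R) (K : nat) (kappa : R).
Hypothesis hS : standing_assumptions S K.

Let bu := xb_neq_xu hS.

(* [p] and [q] are the components along and across the axis; the last two
   conditions say that |y| does not decrease and that the distance to the base
   station does not increase. *)
Definition forward_velocity (r t : R) (p q : R) : Prop :=
  [/\ p ^+ 2 + q ^+ 2 = kappa ^+ 2, 0 <= r * sin t * q &
      r * sin t * q <= p * (L S - r * cos t)].

(** Moving away from the user brings the vehicle nearer to the base station as long as r < L cos t,
    which is the first stopping criterion negated. *)
Lemma radial_forward r t : 0 < kappa -> 0 <= r -> r < L S * cos t ->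
  forward_velocity r t (kappa * cos t) (kappa * sin t).
Proof.
move=> k0 r0 rL; split.
- by rewrite !exprMn -mulrDr cos2Dsin2 mulr1.
- have -> : r * sin t * (kappa * sin t) = r * (kappa * sin t ^+ 2) by ring.
  apply: mulr_ge0 => //; apply: mulr_ge0; [exact: ltW|exact: sqr_ge0].
- rewrite -subr_ge0.
  have -> : kappa * cos t * (L S - r * cos t) - r * sin t * (kappa * sin t) =
    kappa * (L S * cos t - r * (cos t ^+ 2 + sin t ^+ 2)) by ring.
  rewrite cos2Dsin2 mulr1; apply: mulr_ge0; first exact: ltW.
  by rewrite subr_ge0 ltW.
Qed.

(** As the run has not stopped, the radial derivative is negative. With the sign of the angular
    derivative this makes the tangential part of the velocity point away from the axis; the
    condition on the base station comes from [level_arc_rate]. *)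
Lemma contour_forward k r t v : 0 < kappa -> (k <= K)%N -> 0 <= r ->
  ~ stopped S k r t -> contour_velocity S kappa k r t v ->
  forward_velocity r t (along S v) (across S v).
Proof.
move=> kappa0 kK r0 nstop [[dr [dt [g [Fr [Ft dt0] g0 vk vE]]]] [c [c0 cv clev]]].
have rL : r < L S * cos t by rewrite ltNge; apply/negP => Lr; apply: nstop; left.
have dr0 : dr < 0 by rewrite ltNge; apply/negP => dr0; apply: nstop; right; exists dr.
(* At r = 0 the position does not depend on the angle, so the angular derivative would vanish. *)
have rgt0 : 0 < r.
  rewrite lt_neqAle r0 andbT; apply/eqP => r00; move/eqP : dt0; apply.
  have Ft0 : s^-1 * (F S k r (t + s) - F S k r t) @[s --> 0^'-] --> (0 : R).
    rewrite (_ : (fun s => _) = (fun=> 0)); first exact: cvg_cst.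
    by apply/funext => s; rewrite /F /polar -r00 !scale0r subrr mulr0.
  exact: cvg_unique Ft Ft0.
have cost0 : 0 < cos t.
  by rewrite -(pmulr_rgt0 _ (L_gt0 bu)); exact: le_lt_trans rL.
have := lderive_angle_sign hS kK r0 Ft.
set w := r * ((- dt)^-1 * dr) in vE.
move=> dts.
have ws : 0 <= w * sin t.
  have -> : w * sin t = r * (- dr * (dt * sin t * (dt^-1) ^+ 2)).
    by rewrite /w; field.
  apply: mulr_ge0 => //; apply: mulr_ge0; first by rewrite oppr_ge0 ltW.
  exact: mulr_ge0 (sqr_ge0 _).
have pE : along S v = kappa * g * (cos t - w * sin t).
  by rewrite vE alongZ alongD alongZ (along_rot bu) (along_drot bu) mulrN.
have qE : across S v = kappa * g * (sin t + w * cos t).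
  by rewrite vE acrossZ acrossD acrossZ (across_rot bu) (across_drot bu).
have kg0 : 0 < kappa * g by rewrite mulr_gt0.
split.
- by rewrite -(sqr_enorm_frame bu) vk.
- rewrite qE.
  have -> : r * sin t * (kappa * g * (sin t + w * cos t)) =
    r * (kappa * g) * (sin t ^+ 2 + w * sin t * cos t) by ring.
  apply: mulr_ge0; first by rewrite mulr_ge0// ltW.
  by apply: addr_ge0; [exact: sqr_ge0|rewrite mulr_ge0// ltW].
have := level_arc_rate hS kK rgt0 Fr dr0 c0 cv clev.
(* The radial component of the velocity is kappa * g, which is positive. *)
have -> : r * (along S v * cos t + across S v * sin t) = r * (kappa * g).
  rewrite pE qE -[RHS]mulr1 -(cos2Dsin2 t); ring.
move=> /(_ (mulr_gt0 rgt0 kg0)).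
by move: (along S v) (across S v) => p q; lra.
Qed.

End Run.

(** * From duration to length of a branch *)

Lemma arc_length_le (R : realType) (x : R -> 'cV[R]_2) (c T : R) :
  0 <= c -> 0 <= T ->
  (forall s t, 0 <= s -> s <= t -> t <= T -> enorm (x t - x s) <= c * (t - s)) ->
  arc_length 0 T x <= c * T.
Proof.
move=> c0 T0 xc.
have poly s a : 0 <= a -> itv_partition a T s -> polygon_length a T x s <= c * (T - a).
  elim: s a => [|b s IH] a a0; rewrite /polygon_length.
    by move=> /itv_partition_nil ->; rewrite big_nil subrr mulr0.
  move=> abs; rewrite big_nat_recl//=.
  have bs := itv_partition_cons abs; have bT := itv_partition_le bs.
  have ab : a <= b by case: abs => /= /andP[/ltW].
  have := IH b (le_trans a0 ab) bs; rewrite /polygon_length => IHb.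
  have := xc a b a0 ab bT => xab.
  have -> : c * (T - a) = c * (b - a) + c * (T - b) by ring.
  exact: lerD.
(* On the empty set [sup] takes its default value 0. *)
rewrite /arc_length; have [->|/set0P ne] := eqVneq [set polygon_length 0 T x s | s in itv_partition 0 T] set0.
  by rewrite sup0 mulr_ge0.
apply: ge_sup => // _ [s sT <-].
by rewrite -[T in leRHS]subr0; exact: poly.
Qed.

Section Length.
Variables (R : realType) (S : scenario R) (K : nat) (kappa : R).
Hypothesis hS : standing_assumptions S K.

Let bu := xb_neq_xu hS.

Lemma polar_disc r t : 0 <= r -> r < L S * cos t ->
  [/\ 0 <= r * cos t, r * cos t < L S &
      (r * cos t) ^+ 2 + (r * sin t) ^+ 2 <= L S * (r * cos t)].
Proof.
move=> r0 rL; have l0 := L_gt0 bu.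
have cost0 : 0 < cos t by rewrite -(pmulr_rgt0 _ l0); exact: le_lt_trans rL.
split.
- exact: mulr_ge0 (ltW _).
- have rcr : r * cos t <= r by rewrite ler_piMr// cos_le1.
  by rewrite (le_lt_trans rcr)// (lt_le_trans rL)// ler_piMr ?cos_le1// ltW.
rewrite !exprMn -mulrDr cos2Dsin2 mulr1 expr2 mulrCA.
exact: ler_wpM2l (ltW _).
Qed.

Lemma forward_run_duration (k : nat) (sigma r0 delta T : R) (rho theta : R -> R) :
  0 < kappa -> (k <= K)%N -> 0 <= T ->
  branch_run S kappa k sigma r0 delta T rho theta -> kappa * T <= 12 / 10 * L S.
Proof.
move=> kappa0 kK T0 [_ _ xlip nstop vel]; have l0 := L_gt0 bu.
pose x t := polar S (rho t) (theta t).
pose X t := along S (x t - xu S); pose Y t := across S (x t - xu S).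
have XE t : X t = rho t * cos (theta t) by rewrite /X (along_polar bu).
have YE t : Y t = rho t * sin (theta t) by rewrite /Y (across_polar bu).
have rho0 t : 0 <= t -> t < T -> 0 <= rho t.
  by move=> t0 tT; have [] := xlip t t t0 (lexx t) (ltW tT).
have rhoL t : 0 <= t -> t < T -> rho t < L S * cos (theta t).
  move=> t0 tT; rewrite ltNge; apply/negP => Lr.
  by apply: (nstop t); [rewrite t0|left].
have disc t (t0 : 0 <= t) (tT : t < T) := polar_disc (rho0 t t0 tT) (rhoL t t0 tT).
have Yabs t : 0 <= t -> t < T -> `|Y t| <= L S / 2.
  move=> t0 tT; have [_ _] := disc t t0 tT; rewrite -XE -YE.
  exact: (disc_abs_le l0).
(* The stopping criterion is known to fail only before [T], so the disc bounds are available on [[0,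
   T[] alone. If the claim failed at [T], it would also fail at the midpoint of [T1] and [T]. *)
suff main T' : 0 <= T' -> T' < T -> kappa * T' <= 12 / 10 * L S.
  rewrite leNgt; apply/negP => LT.
  pose T1 := 12 / 10 * L S / kappa.
  have T1T : T1 < T by rewrite (ltr_pdivrMr _ _ kappa0) [T * _]mulrC.
  have T10 : 0 <= T1 by rewrite divr_ge0 ?mulr_ge0 ?divr_ge0// ltW.
  have /main : 0 <= (T1 + T) / 2 by lra.
  have Tm : (T1 + T) / 2 < T by lra.
  move=> /(_ Tm).
  have : kappa * T1 = 12 / 10 * L S by rewrite /T1 mulrC divfK// gt_eqF.
  have : kappa * T1 < kappa * T by rewrite ltr_pM2l.
  have -> : kappa * ((T1 + T) / 2) = (kappa * T1 + kappa * T) / 2 by ring.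
  by move: (kappa * T1) (kappa * T) => a b; lra.
move=> T'0 T'T.
(* Growth of the potential at least at speed [kappa] means that [g] does not decrease. *)
pose g t := potential (L S) (X t) (Y t) - kappa * t.
have : g 0 <= g T'.
  (* The constant is 3 * kappa from [potential_lipschitz] plus kappa from the linear term. *)
  apply: (@ae_right_derive_ge0_le _ g (4 * kappa) T' T'0).
    move=> s t /andP[s0 st] tT'.
    have tT := le_lt_trans tT' T'T.
    have [_ xst] := xlip s t s0 st (ltW tT).
    have t0 := le_trans s0 st; have sT := le_lt_trans st tT.
    have Xst : `|X t - X s| <= kappa * (t - s).
      apply: le_trans xst; apply: le_trans (along_le bu _).
      by rewrite /X -alongB opprB addrA subrK.
    have Yst : `|Y t - Y s| <= kappa * (t - s).
      apply: le_trans xst; apply: le_trans (across_le bu _).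
      by rewrite /Y -acrossB opprB addrA subrK.
    have := potential_lipschitz l0 (Yabs s s0 sT) (Yabs t t0 tT) Xst Yst.
    have -> : g t - g s = (potential (L S) (X t) (Y t) - potential (L S) (X s) (Y s)) - kappa * (t - s).
      by rewrite /g; ring.
    move=> pst; apply: (le_trans (ler_normB _ _)).
    rewrite (ger0_norm (mulr_ge0 (ltW kappa0) _)) ?subr_ge0//.
    apply: (le_trans (lerD pst (lexx _))).
    by rewrite le_eqVlt; apply/orP; left; apply/eqP; ring.
  have [A [mA A0 sA]] := vel; exists A; split=> // t nt; apply: sA => velt.
  apply: nt => /andP[t0 tT'].
  have tT := lt_trans tT' T'T.
  have [p [q [Xp Yq [pq yq yqp]]]] : exists p q, [/\
      h^-1 * (X (t + h) - X t) @[h --> 0^'+] --> p,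
      h^-1 * (Y (t + h) - Y t) @[h --> 0^'+] --> q &
      forward_velocity S kappa (rho t) (theta t) p q].
    have [|s [_ _ [[_ [rk th0]]|[_ [v xv cvel]]]]] := velt; first by rewrite t0.
    - exists (kappa * cos (theta t)), (kappa * sin (theta t)); split.
      + have D : is_derive t 1 X (kappa * cos (theta t)).
          have -> : X = rho * (cos \o theta) by apply/funext => u; rewrite XE.
          apply: is_derive_eq (is_deriveM rk (is_derive1_comp (is_derive_cos _) th0)) _.
          by rewrite mulr0 scaler0 add0r [_ *: _]mulrC.
        exact: is_derive_rate D.
      + have D : is_derive t 1 Y (kappa * sin (theta t)).
          have -> : Y = rho * (sin \o theta) by apply/funext => u; rewrite YE.
          apply: is_derive_eq (is_deriveM rk (is_derive1_comp (is_derive_sin _) th0)) _.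
          by rewrite mulr0 scaler0 add0r [_ *: _]mulrC.
        exact: is_derive_rate D.
      + exact: (radial_forward kappa0 (rho0 t (ltW t0) tT) (rhoL t (ltW t0) tT)).
    - exists (along S v), (across S v).
      (* [rate_along] and [rate_across] concern curves at parameter 0, here h |-> x (t + h). *)
      have xv0 : h^-1 *: (x (t + h) - x (t + 0)) @[h --> 0^'+] --> v.
        by rewrite addr0; exact: is_derive_rate.
      have := rate_along xv0; have := rate_across xv0; rewrite addr0 => Yq Xp.
      split; [exact: Xp|exact: Yq|].
      apply: (contour_forward hS kappa0 kK (rho0 t (ltW t0) tT) _ cvel).
      by apply: nstop; rewrite ltW.
  have [X0 XL XY] := disc t (ltW t0) tT.
  have rate := potential_rate_ge l0 _ XY (ltW kappa0) pq yq yqp.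
  exists (p + `|q| * (1 - `|Y t| / (3 * L S)) - kappa).
    by rewrite subr_ge0 YE; apply: rate; rewrite X0.
  have yq' : 0 <= Y t * q by rewrite YE.
  have := cvg_rate_potential l0 Xp Yq yq' => PP.
  have H : h^-1 * (potential (L S) (X (t + h)) (Y (t + h)) - potential (L S) (X t) (Y t)) - kappa
     @[h --> 0^'+] --> p + `|q| * (1 - `|Y t| / (3 * L S)) - kappa.
    by apply: cvgB => //; exact: cvg_cst.
  apply: cvg_trans H; apply: near_eq_cvg; near=> h.
  have h0 : h != 0 by rewrite gt_eqF.
  rewrite /g; move: (potential _ _ _) (potential _ _ _) => a b.
  by field.
have [X0 XL XY] := disc T' T'0 T'T.
have T0' := le_lt_trans T'0 T'T.
have [X00 _ _] := disc 0 (lexx 0) T0'.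
have := potential_le l0 XY; rewrite -XE -YE => pT.
have := potential_ge0 l0 X00 (Yabs 0 (lexx 0) T0'); rewrite -XE => p0.
rewrite /g mulr0 subr0 => gg.
have : kappa * T' <= potential (L S) (X T') (Y T') - potential (L S) (X 0) (Y 0).
  by rewrite lerBrDr addrC -lerBrDr.
move=> /le_trans; apply; apply: le_trans pT.
by rewrite gerBl.
Unshelve. all: by end_near. Qed.

(** The bound on the duration is uniform in [delta], hence survives the limit. *)
Lemma branch_length_le (k : nat) (sigma r0 l : R) : 0 < kappa -> (k <= K)%N ->
  branch_length S kappa k sigma r0 l -> l <= 12 / 10 * L S.
Proof.
move=> kappa0 kK bl; apply/ler_addgt0Pr => e e0.
have [delta [T [rho [theta [_ T0 run le]]]]] := bl e e0.
have := forward_run_duration kappa0 kK T0 run => kT.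
have [_ _ xlip _ _] := run.
have := arc_length_le (ltW kappa0) T0 (fun s t s0 st tT => (xlip s t s0 st tT).2).
move: le; rewrite ltr_norml => /andP[le _] al.
have := le_trans al kT.
move: le; move: (arc_length _ _ _) => a; lra.
Qed.

End Length.

Theorem theorem2 (R : realType) (K : nat) (sc : scenario R)
    (hS : standing_assumptions sc K)
    (kappa : R) (hkappa : 0 < kappa)
    (rho0 : nat -> R)
    (hrho0 : forall k, (1 <= k < K)%N -> is_critical sc k (rho0 k))
    (lenR lenL : nat -> R)
    (hR : forall k, (1 <= k < K)%N ->
       branch_length sc kappa k 1 (rho0 k) (lenR k))
    (hL : forall k, (1 <= k < K)%N ->
       branch_length sc kappa k (-1) (rho0 k) (lenL k)) :
  search_length sc K lenR lenL <= (24 / 10 * K%:R - 14 / 10) * L sc.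
Proof.
have sumle : \sum_(1 <= k < K) (lenR k + lenL k) <=
    \sum_(1 <= k < K) (24 / 10 * L sc).
  apply: ler_sum_nat => k k1K; have /andP[_ /ltnW kK] := k1K.
  have := branch_length_le hS hkappa kK (hR k k1K).
  have := branch_length_le hS hkappa kK (hL k k1K).
  lra.
(* There are K - 1 pairs of branches, and L + (K - 1) * 2.4 L = (2.4 K - 1.4) L; K >= 1 turns the
   natural subtraction into a real one. *)
rewrite sumr_const_nat -[_ *+ _]mulr_natr natrB ?(K_ge1 hS)// in sumle.
rewrite /search_length; lra.
Qed.
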